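(* Let $G$ be a connected non-complete graph of order $n$ with $9\leq n\leq 24$. If $C(G)$ is a linear forest and $\delta(G)\geq \max\{3, \frac{n-4}{5}\}$, then $cfc(G) = 2$.
   Context: All graphs are finite, simple and undirected; $\delta(G)$ is the minimum degree. For a graph $G$, $C(G)$ denotes the subgraph of $G$ induced by the set of cut-edges of $G$. A linear forest is a forest each of whose components is a path (an edgeless graph counts). An edge-coloring of a connected graph (adjacent edges may receive the same color) is a conflict-free connection coloring if every pair of distinct vertices is joined by a path containing at least one color used on exactly one edge of that path. The conflict-free connection number $cfc(G)$ is the smallest number of colors in a conflict-free connection coloring of $G$. *)

(* Defs.v *)
From mathcomp Require Import all_boot.

Set Implicit Arguments.
Unset Strict Implicit.
Unset Printing Implicit Defensive.

Record sgraph := SGraph {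
  vertex :> finType;
  adj : rel vertex;
  adj_sym : symmetric adj;
  adj_irr : irreflexive adj
}.

(* An edge is the two-element set of its endpoints. *)
Definition edges (G : sgraph) : {set {set G}} :=
  [set [set p.1; p.2] | p in [pred p : G * G | adj p.1 p.2]].

Definition connected (G : sgraph) : Prop := forall x y : G, connect (@adj G) x y.

Definition complete (G : sgraph) : Prop := forall x y : G, x != y -> adj x y.

Definition degree (G : sgraph) (x : G) : nat := #|[set y | adj x y]|.

(* Degrees are smaller than #|G|, so the default value #|G| of the iterated
   minimum is never attained on a nonempty graph. *)
Definition min_degree (G : sgraph) : nat := \big[minn/#|G|]_(x : G) degree x.

Definition isomorphic (G H : sgraph) : Prop :=
  exists2 f : G -> H, bijective f & forall x y, adj (f x) (f y) = adj x y.

Section Subgraphs.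
Variable G : sgraph.

Definition induced_adj (A : {set G}) : rel {x : G | x \in A} :=
  [rel u v | adj (val u) (val v)].

Lemma induced_adj_sym A : symmetric (@induced_adj A).
Proof. move=> u v; exact: adj_sym. Qed.

Lemma induced_adj_irr A : irreflexive (@induced_adj A).
Proof. by move=> u; rewrite /induced_adj /= adj_irr. Qed.

Definition induced (A : {set G}) : sgraph :=
  SGraph (@induced_adj_sym A) (@induced_adj_irr A).

Definition edge_induced_adj (F : {set {set G}}) : rel {x : G | x \in cover F} :=
  [rel u v | adj (val u) (val v) && ([set val u; val v] \in F)].

Lemma edge_induced_adj_sym F : symmetric (@edge_induced_adj F).
Proof. by move=> u v; rewrite /edge_induced_adj /= adj_sym setUC. Qed.

Lemma edge_induced_adj_irr F : irreflexive (@edge_induced_adj F).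
Proof. by move=> u; rewrite /edge_induced_adj /= adj_irr. Qed.

Definition edge_induced (F : {set {set G}}) : sgraph :=
  SGraph (@edge_induced_adj_sym F) (@edge_induced_adj_irr F).

Definition component (x : G) : sgraph :=
  induced [set y | connect (@adj G) x y].

Definition del_edge_adj (e : {set G}) : rel G :=
  [rel u v | adj u v && ([set u; v] != e)].

(* Edges whose deletion increases the number of connected components. *)
Definition cut_edges : {set {set G}} :=
  [set e in edges G | n_comp (@adj G) predT < n_comp (del_edge_adj e) predT].

Definition cut_edge_subgraph : sgraph := edge_induced cut_edges.

End Subgraphs.

Definition path_adj (n : nat) : rel 'I_n :=
  [rel i j : 'I_n | (i.+1 == j :> nat) || (j.+1 == i :> nat)].

Lemma path_adj_sym n : symmetric (@path_adj n).
Proof. by move=> i j; rewrite /path_adj /= orbC. Qed.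

Lemma path_adj_irr n : irreflexive (@path_adj n).
Proof. by move=> i; rewrite /path_adj /= orbb gtn_eqF. Qed.

Definition path_graph (n : nat) : sgraph :=
  SGraph (@path_adj_sym n) (@path_adj_irr n).

Definition forest (G : sgraph) : Prop :=
  forall s : seq G, 2 < size s -> ~ ucycle (@adj G) s.

Definition linear_forest (G : sgraph) : Prop :=
  forest G /\ forall x : G, exists n, isomorphic (component x) (path_graph n).

(* x :: p is a path from x to y without repeated vertices. *)
Definition is_path (G : sgraph) (x y : G) (p : seq G) : Prop :=
  [/\ path (@adj G) x p, last x p = y & uniq (x :: p)].

Definition path_edges (G : sgraph) (x : G) (p : seq G) : seq {set G} :=
  pairmap (fun u v => [set u; v]) x p.

(* Only the values of a coloring on edges G are relevant. *)
Definition edge_coloring (G : sgraph) := {set G} -> nat.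

Definition conflict_free_path (G : sgraph) (c : edge_coloring G)
    (x : G) (p : seq G) : Prop :=
  exists a : nat, count_mem a (map c (path_edges x p)) = 1.

Definition cfc_coloring (G : sgraph) (c : edge_coloring G) : Prop :=
  forall x y : G, x != y ->
    exists2 p : seq G, is_path x y p & conflict_free_path c x p.

Definition num_colors (G : sgraph) (c : edge_coloring G) : nat :=
  size (undup [seq c e | e in edges G]).

(* cfc(G) = k.  A relation, because cfc(G) exists only for connected G. *)
Definition cfc_eq (G : sgraph) (k : nat) : Prop :=
  (exists2 c : edge_coloring G, cfc_coloring c & num_colors c = k) /\
  (forall c : edge_coloring G, cfc_coloring c -> k <= num_colors c).

(* Main.v *)
Require Import Defs.
From mathcomp Require Import all_boot all_order all_algebra.
From mathcomp Require Import zify.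

(** Let [F] be the complement of the edge set of a spanning tree, and suppose some
    set [S] of at most one bridge meets every pair of adjacent bridges.  Colour
    the edges of [F] and [S] with 1 and all others with 0.  Given [u != v],
    consider the tree path from [u] to [v].  If it contains the bridge in [S], that is
    its only edge of colour 1.  Otherwise, if it contains a non-bridge [e], then
    some edge of [F] reconnects the two halves of the tree minus [e]; going
    through it gives a path with exactly one edge of [F], and this path crosses
    the same bridges as the tree path, hence none in [S].  Otherwise it is a
    single bridge.

    Such an [S] exists unless there are two disjoint pairs of adjacent
    bridges, because a vertex lies on at most two bridges.  Deleting those
    four bridges leaves at least five components, and each of them contains a
    vertex incident with none of the four, hence at least [min_degree G + 1]
    vertices, which contradicts [#|G| <= 5 * min_degree G + 4]. *)

Set Implicit Arguments.
Unset Strict Implicit.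
Unset Printing Implicit Defensive.

(** * Connected components of finite relations *)

Section Connectivity.
Variable T : finType.
Implicit Types e : rel T.

(** Sending each root of [e'] to its root under [e] maps onto the roots of [e]. The map is not
    injective: the [e']-roots of [x] and [y] differ but have the same image. *)
Lemma ltn_n_comp e e' x y :
  connect_sym e -> connect_sym e' -> subrel (connect e') (connect e) ->
  connect e x y -> ~~ connect e' x y -> n_comp e predT < n_comp e' predT.
Proof.
move=> sym_e sym_e' sub exy e'xy.
rewrite /n_comp_mem.
have root_root z :
    fingraph.root e (fingraph.root e' z) = fingraph.root e z.
  by apply/eqP; rewrite root_connect // sym_e; apply/sub/connect_root.
set A := predI _ _; set B := predI _ _.
have -> : #|A| = #|fingraph.root e @: B|.
  apply: eq_card => z; rewrite !inE andbT; apply/idP/imsetP.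
    move=> /eqP rz; exists (fingraph.root e' z); last by rewrite root_root rz.
    by rewrite !inE andbT roots_root.
  by case=> w _ ->; rewrite roots_root.
rewrite ltn_neqAle leq_imset_card andbT.
apply: contra e'xy => /imset_injP injB; rewrite -root_connect //.
apply/eqP/injB; rewrite ?inE ?andbT ?roots_root //.
by rewrite !root_root; apply/eqP; rewrite root_connect.
Qed.

Lemma leq_mul_n_comp e k :
  connect_sym e -> (forall x, k <= #|connect e x|) ->
  n_comp e predT * k <= #|T|.
Proof.
move=> sym_e leq_k; rewrite -sum1_card.
rewrite (partition_big (fingraph.root e) (roots e)) /=.
  rewrite /n_comp_mem -sum_nat_const.
  rewrite (eq_bigl (roots e)); last by move=> x; rewrite !inE andbT.
  apply: leq_sum => x /eqP rx; rewrite sum1_card.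
  apply: leq_trans (leq_k x) _; apply/subset_leq_card/subsetP => y exy.
  by apply/eqP; rewrite -[RHS]rx; apply/eqP; rewrite root_connect // sym_e.
by move=> x _; apply: roots_root.
Qed.

Lemma connect_exit e (P : pred T) x y :
  connect e x y -> P x -> ~~ P y -> exists z w, [/\ e z w, P z & ~~ P w].
Proof.
case/connectP=> p; elim: p x => [|z p IHp] x /=; first by move=> _ -> ->.
case/andP=> exz ezp lp Px nPy; case: (boolP (P z)) => [Pz|nPz].
  exact: IHp ezp lp Pz nPy.
by exists x, z.
Qed.

Lemma connect_uniq_path e x y :
  connect e x y -> exists p, [/\ path e x p, last x p = y & uniq (x :: p)].
Proof. by case/connectP=> p /shortenP[q eq uq _] ->; exists q. Qed.

Lemma set2_eq (a b x y : T) :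
  [set a; b] = [set x; y] -> (a = x /\ b = y) \/ (a = y /\ b = x).
Proof.
move=> E.
have: a \in [set x; y] by rewrite -E !inE eqxx.
have: b \in [set x; y] by rewrite -E !inE eqxx orbT.
have: x \in [set a; b] by rewrite E !inE eqxx.
have: y \in [set a; b] by rewrite E !inE eqxx orbT.
rewrite !inE => /orP[]/eqP ? /orP[]/eqP ? /orP[]/eqP ? /orP[]/eqP ?; subst; tauto.
Qed.

End Connectivity.

Lemma count_uniq1 (T : eqType) (P : pred T) (s : seq T) a :
  uniq s -> a \in s -> P a -> {in s, forall b, P b -> b = a} -> count P s = 1.
Proof.
move=> us sa Pa Ps; rewrite (@eq_in_count _ _ (pred1 a)) ?count_uniq_mem ?sa //.
by move=> b sb /=; apply/idP/eqP => [/Ps->|->].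
Qed.

(** * Edge deletion, bridges and edges along paths *)

Section Graph.
Variable G : sgraph.
Implicit Types (F S : {set {set G}}) (e : {set G}) (x y : G) (p : seq G).

Definition del F u v := adj u v && ([set u; v] \notin F).

Arguments del F u v /.

Lemma del_sym F : symmetric (del F).
Proof. by move=> u v; rewrite /del /= adj_sym setUC. Qed.

Lemma connect_del_sym F : connect_sym (del F).
Proof. exact/sym_connect_sym/del_sym. Qed.

Lemma del0 : del set0 =2 @adj G.
Proof. by move=> u v; rewrite /= inE andbT. Qed.

Lemma connect_delS F F' : F' \subset F -> subrel (connect (del F)) (connect (del F')).
Proof.
move=> sF; apply: connect_sub => x y /andP[xy /(contra (subsetP sF _)) nF].
by apply: connect1; rewrite /= xy.
Qed.

Lemma connect_delU1 F x y :
  connect (del ([set x; y] |: F)) x y ->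
  connect (del ([set x; y] |: F)) =2 connect (del F).
Proof.
move=> cxy u v; apply/idP/idP; first exact/connect_delS/subsetU1.
apply: connect_sub u v => u v /andP[uv nF].
case: (eqVneq [set u; v] [set x; y]) => [E|ne]; last first.
  by apply: connect1; rewrite /= uv !inE negb_or ne.
by case: (set2_eq E) => -[-> ->] //; rewrite connect_del_sym.
Qed.

Lemma edgesP e : reflect (exists x y, e = [set x; y] /\ adj x y) (e \in edges G).
Proof.
apply: (iffP imsetP) => [[[x y] /= xy ->]|[x [y [-> xy]]]]; first by exists x, y.
by exists (x, y).
Qed.

Lemma mem_edges x y : adj x y -> [set x; y] \in edges G.
Proof. by move=> xy; apply/edgesP; exists x, y. Qed.

(** Replaces the count of components by a local test. If the ends stay connected, the deletion
    changes no connection, by [connect_delU1]; otherwise [ltn_n_comp] applies. *)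
Lemma cut_edgeE x y :
  adj x y -> ([set x; y] \in cut_edges G) = ~~ connect (del [set [set x; y]]) x y.
Proof.
move=> xy; rewrite inE mem_edges //=.
have E : del_edge_adj [set x; y] =2 del [set [set x; y]].
  by move=> u v; rewrite /= !inE.
rewrite (eq_n_comp (eq_connect E)) -(eq_n_comp (eq_connect del0)).
apply/idP/idP.
  apply: contraL => cxy; rewrite -leqNgt -(setU0 [set [set x; y]]).
  by rewrite (eq_n_comp (connect_delU1 _)) // setU0.
move=> ncxy; apply: ltn_n_comp ncxy; try exact: connect_del_sym.
  exact/connect_delS/sub0set.
by apply: connect1; rewrite del0.
Qed.

Lemma cut_edge_ends x y : [set x; y] \in cut_edges G -> adj x y.
Proof.
rewrite inE => /andP[/edgesP[a [b [E ab]]] _].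
by case: (set2_eq E) => -[-> ->] //; rewrite adj_sym.
Qed.

Lemma mem_path_edges x p e : e \in path_edges x p -> e \subset x :: p.
Proof.
elim: p x => [|y p IHp] x //=; rewrite inE => /orP[/eqP->|/IHp sub].
  by apply/subsetP=> z; rewrite !inE => /orP[]->; rewrite ?orbT.
by apply: subset_trans sub _; apply/subsetP=> z; rewrite !inE => ->; rewrite orbT.
Qed.

Lemma path_edges_uniq x p : uniq (x :: p) -> uniq (path_edges x p).
Proof.
elim: p x => [|y p IHp] x //= /andP[nx uyp]; rewrite IHp // andbT.
by apply: contra nx => /mem_path_edges/subsetP; apply; rewrite !inE eqxx.
Qed.

Lemma path_del F x p :
  path (del F) x p = path (@adj G) x p && all [predC F] (path_edges x p).
Proof.
elim: p x => [|y p IHp] x //=; rewrite IHp -!andbA; congr andb.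
by rewrite andbCA.
Qed.

Lemma path_edges_sub x p : path (@adj G) x p -> {subset path_edges x p <= edges G}.
Proof.
elim: p x => [|y p IHp] x //= /andP[xy yp] e; rewrite inE => /orP[/eqP->|].
  exact: mem_edges.
exact: IHp.
Qed.

(** As the vertices of the path are distinct, it uses [e] only once, so the pieces before and after
    [e] both avoid it. *)
Lemma path_split_edge F x p e :
  path (del F) x p -> uniq (x :: p) -> e \in path_edges x p ->
  exists a b, [/\ e = [set a; b], del F a b, connect (del (e |: F)) x a &
                  connect (del (e |: F)) b (last x p)].
Proof.
elim: p x => [|y p IHp] x //= /andP[xy yp] /andP[nx uyp].
have notx : [set x; y] \notin path_edges y p.
  by apply: contra nx => /mem_path_edges/subsetP; apply; rewrite !inE eqxx.
rewrite inE => /orP[/eqP->|ep].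
  exists x, y; split=> //; apply/connectP; exists p => //.
  move: yp; rewrite !path_del => /andP[-> /allP nF] /=; apply/allP=> f fp /=.
  have := nF f fp; rewrite !inE negb_or => ->; rewrite andbT.
  by apply: contraNneq notx => <-.
have [a [b [E ab ya bl]]] := IHp y yp uyp ep.
exists a, b; split=> //; apply: connect_trans ya; apply: connect1.
case/andP: xy => /= -> nF; rewrite !inE negb_or nF andbT.
by apply: contraNneq notx => ->.
Qed.

(** If [q] avoided [e], the two pieces of [p] on either side of [e], joined through [q], would
    connect the ends of [e] without using [e]. *)
Lemma cut_edge_unavoidable x p q e :
  path (@adj G) x p -> uniq (x :: p) -> path (@adj G) x q ->
  last x p = last x q -> e \in cut_edges G ->
  e \in path_edges x p -> e \in path_edges x q.
Proof.
move=> xp up xq lpq ce ep; apply/negPn/negP => nq.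
have xp0 : path (del set0) x p by rewrite (eq_path del0).
have [a [b [E ab xa bl]]] := path_split_edge xp0 up ep.
rewrite setU0 in xa bl; rewrite del0 in ab.
move: ce; rewrite E cut_edgeE // -E => /negP; apply.
rewrite connect_del_sym in xa; apply: connect_trans xa _.
rewrite connect_del_sym; apply: connect_trans bl _; rewrite connect_del_sym lpq.
apply/connectP; exists q => //; rewrite path_del xq; apply/allP => f fq /=.
by rewrite inE; apply: contraNneq nq => <-.
Qed.

(** * Spanning trees and the two-colouring *)

Definition spans F := [forall x, forall y, connect (del F) x y].

Lemma spansP F : reflect (forall x y, connect (del F) x y) (spans F).
Proof. by apply: (iffP forallP) => H x; apply/forallP/H. Qed.

(** What is left outside a maximal [F] is a spanning tree. Without [e] it falls into two sides,
    containing [x] and [last x p]. As [e] is not a bridge, some other edge of [G] joins the sides;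
    it serves as [f]. *)
Lemma exchange_path F x p e :
  maxset spans F -> path (del F) x p -> uniq (x :: p) ->
  e \in path_edges x p -> e \notin cut_edges G ->
  exists q f, [/\ is_path x (last x p) q, f \in path_edges x q, f \in F &
                  {in path_edges x q, forall g, g \in F -> g = f}].
Proof.
case/maxsetP=> /spansP spF maxF xp up ep nce.
have [a [b [E ab xa bl]]] := path_split_edge xp up ep.
set F' := e |: F in xa bl; set v := last x p in bl *.
(* If the ends of [e] stayed connected, [e |: F] would still span, so maximality would put [e] in
   [F], while [p] avoids [F]. *)
have nab : ~~ connect (del F') a b.
  apply/negP=> cab; have eF : e \in F.
    rewrite -(maxF F') ?setU11 ?subsetU1 //; apply/spansP=> u w.
    by move: cab; rewrite /F' E => /connect_delU1->.
  by case/andP: ab; rewrite -E eF.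
have nxv : ~~ connect (del F') x v.
  apply: contra nab => xv; rewrite connect_del_sym in xa.
  by apply: connect_trans xa (connect_trans xv _); rewrite connect_del_sym.
(* There is no third side: putting [e] back reconnects everything, and both ends of [e] already lie
   on the sides of [x] and [v]. *)
have side y : ~~ connect (del F') x y -> connect (del F') y v.
  move=> nxy; rewrite connect_del_sym; apply: contraR nxy => nvy.
  pose P := [pred w | connect (del F') x w || connect (del F') v w].
  apply/negPn/negP => nxy.
  have Px : P x by rewrite /= connect0.
  have nPy : ~~ P y by rewrite /= negb_or nxy.
  have [z [w [/andP[zw nF] Pz nPw]]] := connect_exit (spF x y) Px nPy.
  case: (eqVneq [set z; w] e) => [Ezw|ne]; last first.
    have zw' : connect (del F') z w.
      by apply: connect1; rewrite /= zw !inE negb_or ne.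
    by case/negP: nPw; case/orP: Pz => c; rewrite /= (connect_trans c zw') ?orbT.
  rewrite E in Ezw; case/negP: nPw; rewrite /= (connect_del_sym _ v).
  by case: (set2_eq Ezw) => -[_ ->]; rewrite ?xa ?bl ?orbT.
have cxv : connect (del [set e]) x v.
  have ab' : adj a b by case/andP: ab.
  rewrite E cut_edgeE // negbK -E in nce.
  have sF : [set e] \subset F' by rewrite sub1set setU11.
  exact: connect_trans (connect_delS sF xa) (connect_trans nce (connect_delS sF bl)).
(* A walk from [x] to [v] avoiding [e] must leave the side of [x]. The edge by which it does so lies
   in [F], since otherwise its far end would belong to that side too. *)
have [y [z [/andP[yz ne] xy nxz]]] := connect_exit cxv (connect0 _ _) nxv.
rewrite inE in ne.
have yzF : [set y; z] \in F.
  apply: contraR nxz => nF; apply: connect_trans xy _; apply: connect1.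
  by rewrite /= yz !inE negb_or ne.
have [q1 [xq1 lq1 uq1]] := connect_uniq_path xy.
have [q2 [zq2 lq2 uq2]] := connect_uniq_path (side z nxz).
have nF r w : path (del F') w r -> {in path_edges w r, forall g, g \notin F}.
  rewrite path_del => /andP[_ /allP H] g /H /=.
  by rewrite !inE negb_or => /andP[].
have padj r w : path (del F') w r -> path (@adj G) w r.
  by rewrite path_del => /andP[].
(* [q1] stays on the side of [x] and [q2] on that of [v]. The sides are disjoint, so no vertex
   repeats, and neither piece uses [F]. *)
exists (q1 ++ z :: q2), [set y; z]; split=> //.
- split; first by rewrite cat_path padj //= lq1 yz padj.
    by rewrite last_cat.
  rewrite -cat_cons cat_uniq uq1 uq2 andbT; apply/hasPn => w wq2.
  apply/negP => wq1; case/negP: nxv.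
  have xw := path_connect xq1 wq1; apply: connect_trans xw _.
  rewrite connect_del_sym -lq2.
  have zl : connect (del F') z (last z q2) by apply/connectP; exists q2.
  rewrite connect_del_sym in zl.
  exact: connect_trans zl (path_connect zq2 wq2).
- by rewrite /path_edges pairmap_cat lq1 /= mem_cat !inE eqxx orbT.
- move=> g; rewrite /path_edges pairmap_cat lq1 /= mem_cat inE.
  by case/or3P=> [/(nF _ _ xq1)/negP//|/eqP//|/(nF _ _ zq2)/negP//].
Qed.

Lemma cfc_coloring_of_bridge_cover S :
  connected G -> S \subset cut_edges G -> {in S &, forall e f, e = f} ->
  (forall u v w, u != w -> [set u; v] \in cut_edges G ->
     [set v; w] \in cut_edges G -> ([set u; v] \in S) || ([set v; w] \in S)) ->
  exists2 c : edge_coloring G, cfc_coloring c & num_colors c <= 2.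
Proof.
move=> cG sS S1 cover.
(* [F] ranges over all families of vertex sets, so a maximal one also contains every set that is not
   an edge; only its edges matter for the colouring. *)
have [F maxF _] : {F | maxset spans F & set0 \subset F}.
  by apply: maxset_exists; apply/spansP => x y; rewrite (eq_connect del0).
pose P := [pred e | (e \in F) || (e \in S)].
exists (fun e => nat_of_bool (P e)); last first.
  rewrite /num_colors -[2]/(size [:: 0; 1]).
  apply: uniq_leq_size => [|k]; first exact: undup_uniq.
  by rewrite mem_undup => /mapP[e _ ->]; case: (P e).
have cfpath x q f : uniq (x :: q) -> f \in path_edges x q -> P f ->
    {in path_edges x q, forall g, P g -> g = f} ->
    conflict_free_path (fun e => nat_of_bool (P e)) x q.
  move=> uq fq Pf Pq; exists 1; rewrite count_map.
  rewrite -[RHS](count_uniq1 (path_edges_uniq uq) fq Pf Pq).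
  by apply: eq_count => g /=; case: (_ || _).
move=> u v uv.
have /maxsetP[/spansP spF _] := maxF.
have [p [up lp uniqp]] := connect_uniq_path (spF u v).
have adjp : path (@adj G) u p by move: up; rewrite path_del => /andP[].
have nFp g : g \in path_edges u p -> g \notin F.
  by move: up; rewrite path_del => /andP[_ /allP H] /H.
have isp : is_path u v p by [].
case: (boolP (has (mem S) (path_edges u p))) => [/hasP[s sp inS]|/hasPn nS].
  exists p => //; apply: cfpath sp _ _ => //=; first by apply/orP; right.
  move=> g gp; rewrite (negPf (nFp g gp)) /= => gS; exact: S1.
have nSp g : g \in path_edges u p -> g \notin S by move/nS.
(* If [p] consists of bridges outside [S], then [cover] rules out two consecutive edges. So [p] is a
   single edge, of colour 0, which is why the witness is 0 here. *)
case: (boolP (all (mem (cut_edges G)) (path_edges u p))) => [/allP allc|].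
  exists p => //; exists 0; case: p => [|w [|w' p]] in
    lp allc nSp uniqp nFp {nS up adjp isp} *.
  - by rewrite -lp /= eqxx in uv.
  - have := nSp [set u; w]; have := nFp [set u; w].
    by rewrite !inE eqxx /= => /(_ isT)/negPf-> /(_ isT)/negPf->.
  - have uw' : u != w' by move: uniqp; rewrite /= !inE !negb_or -!andbA => /and3P[].
    have e1 : [set u; w] \in path_edges u [:: w, w' & p] by rewrite inE eqxx.
    have e2 : [set w; w'] \in path_edges u [:: w, w' & p] by rewrite !inE eqxx orbT.
    case/orP: (cover u w w' uw' (allc _ e1) (allc _ e2)) => eS.
      by case/negP: (nSp _ e1).
    by case/negP: (nSp _ e2).
case/allPn=> e ep nce.
have [q [f [[uq lq uniqq] fq fF Fq]]] := exchange_path maxF up uniqp ep nce.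
exists q; first by split=> //; rewrite lq.
apply: cfpath fq _ _ => //=; first by rewrite fF.
move=> g gq /orP[gF|gS]; first exact: Fq.
(* A bridge of [S] on [q] would also lie on the tree path [p], which avoids [S]. *)
have := cut_edge_unavoidable uq uniqq adjp lq (subsetP sS g gS) gq.
by move/nSp; rewrite gS.
Qed.

(** A path between two non-adjacent vertices has at least two edges. A colour occurring exactly once
    on it therefore leaves an edge of another colour. *)
Lemma cfc_num_colors_ge2 (c : edge_coloring G) :
  ~ complete G -> cfc_coloring c -> 2 <= num_colors c.
Proof.
move=> ncG cfc.
have : ~~ [forall x : G, forall y : G, (x != y) ==> adj x y].
  apply/negP => /forallP H; apply: ncG => x y xy.
  by move/forallP/(_ y)/implyP: (H x); apply.
case/forallPn=> x /forallPn[y]; rewrite negb_imply => /andP[xy nxy].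
have [p [xp lp up] [a cnt]] := cfc x y xy.
set l := map c _ in cnt.
have size_l : 1 < size l.
  rewrite size_map size_pairmap; case: p => [|w [|w' p]] //= in lp xp {up l cnt} *.
    by rewrite lp eqxx in xy.
  by move: xp nxy; rewrite lp andbT => ->.
have sub_l : {subset l <= [seq c e | e in edges G]}.
  move=> k /mapP[e ep ->]; apply/mapP; exists e => //.
  by rewrite mem_enum; apply: path_edges_sub ep.
have al : a \in l by rewrite -has_pred1 has_count cnt.
have [b bl ba] : exists2 b, b \in l & b != a.
  apply/hasP; rewrite has_count -(ltn_add2l (count_mem a l)) addn0.
  by rewrite (count_predC (pred1 a)) cnt.
rewrite /num_colors -[2]/(size [:: a; b]).
apply: uniq_leq_size; first by rewrite /= inE eq_sym ba.
by move=> k; rewrite !inE mem_undup => /orP[]/eqP->; apply: sub_l.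
Qed.

(** * Bridges at a vertex and components left by deleting bridges *)

Lemma linear_forest_cut_degree x :
  linear_forest (cut_edge_subgraph G) ->
  #|[set y | [set x; y] \in cut_edges G]| <= 2.
Proof.
case=> _ iso; rewrite leqNgt; apply/negP.
case/card_gt2P=> u [v [w [[xu xv xw] [uv vw wu]]]].
rewrite in_set in xu; rewrite in_set in xv; rewrite in_set in xw.
have cov y z : [set y; z] \in cut_edges G -> y \in cover (cut_edges G).
  move=> yz; apply/bigcupP; exists [set y; z] => //; exact: set21.
have Cx := cov x u xu.
pose X : cut_edge_subgraph G := exist _ x Cx.
have nbr y : [set x; y] \in cut_edges G ->
   exists Y : component X, val (val Y) = y /\ adj X (val Y).
  move=> xy; have Cy : y \in cover (cut_edges G) by apply: (cov y x); rewrite setUC.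
  pose Y : cut_edge_subgraph G := exist _ y Cy.
  have XY : adj X Y by apply/andP; split; first exact: cut_edge_ends xy.
  have cY : Y \in [set Z | connect (@adj (cut_edge_subgraph G)) X Z].
    by rewrite inE connect1.
  by exists (exist _ Y cY).
have cX : X \in [set Z | connect (@adj (cut_edge_subgraph G)) X Z].
  by rewrite inE connect0.
pose X' : component X := exist _ X cX.
have [U [EU XU]] := nbr u xu; have [V [EV XV]] := nbr v xv; have [W [EW XW]] := nbr w xw.
have [n [f /bij_inj injf fadj]] := iso X.
pose g A := nat_of_ord (f A : 'I_n).
(* Adjacent vertices of a path graph have consecutive indices. Three distinct neighbours would need
   three distinct indices next to that of [X'], where there are at most two. *)
have gadj Y : adj X (val Y) -> (g X').+1 = g Y \/ (g Y).+1 = g X'.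
  move=> XY; have : adj (f X') (f Y) by rewrite fadj.
  by case/orP=> /eqP; [left | right].
have gneq (A B : component X) : val (val A) != val (val B) -> g A <> g B.
  by move=> + /val_inj/injf AB; rewrite AB eqxx.
have := gneq U V; have := gneq V W; have := gneq W U; rewrite EU EV EW.
move=> /(_ wu) WU /(_ vw) VW /(_ uv) UV.
move: (gadj U XU) (gadj V XV) (gadj W XW) WU VW UV.
move: (g X') (g U) (g V) (g W) => gX gU gV gW; clear; lia.
Qed.

(** An edge that is not a bridge lies on a cycle. Take for [z] the other neighbour of [x] on that
    cycle; the edge to [z] lies on it as well. *)
Lemma non_cut_two_neighbors x y :
  adj x y -> [set x; y] \notin cut_edges G ->
  exists z, [/\ adj x z, z != y & [set x; z] \notin cut_edges G].
Proof.
move=> xy; rewrite cut_edgeE // negbK => cxy.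
have [[|z p] [/= xzp lp uxzp]] := connect_uniq_path cxy.
  by rewrite lp adj_irr in xy.
move: xzp; rewrite path_del => /andP[/andP[xz nzy] /andP[zp _]].
have zNy : z != y by apply: contraNneq nzy => ->; rewrite inE.
case/andP: uxzp => nx _.
exists z; split=> //; rewrite cut_edgeE // negbK connect_del_sym.
apply: (@connect_trans _ _ y).
  apply/connectP; exists p => //; rewrite path_del zp; apply/allP => e ep /=.
  rewrite inE; apply: contraNneq nx => Ee; rewrite Ee in ep.
  by move/mem_path_edges/subsetP: ep; apply; rewrite !inE eqxx.
apply: connect1; rewrite /= adj_sym xy inE; apply/eqP => /set2_eq.
case=> -[yx _]; last by rewrite yx eqxx in zNy.
by rewrite yx adj_irr in xy.
Qed.

(** Each bridge separates its ends when deleted, so restoring the bridges one at a time lowers the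
    count each time. The vertex [x] provides the one component needed when [F] is empty. *)
Lemma n_comp_del_cut_edges F x :
  F \subset cut_edges G -> #|F| < n_comp (del F) predT.
Proof.
have [k] := ubnP #|F|; elim: k F => // k IHk F.
case: (set_0Vmem F) => [->|[e eF]] ltk sF.
  rewrite cards0; apply/card_gt0P; exists (fingraph.root (del set0) x).
  by rewrite !inE andbT roots_root //; apply: connect_del_sym.
have ce := subsetP sF e eF.
have sF' : F :\ e \subset cut_edges G by apply: subset_trans sF; apply: subsetDl.
rewrite (cardsD1 e) eF in ltk *.
apply: leq_ltn_trans (IHk _ ltk sF') _.
move: (ce); rewrite inE => /andP[/edgesP[a [b [E ab]]] _].
apply: (@ltn_n_comp _ _ _ a b); try exact: connect_del_sym.
- exact/connect_delS/subsetDl.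
- by apply: connect1; rewrite /= ab E !inE eqxx.
- rewrite E cut_edgeE // -E in ce; apply: contra ce; apply: connect_delS.
  by rewrite sub1set.
Qed.

Lemma bridge_pair_disconnected F x y z :
  x != z -> [set x; y] \in cut_edges G -> [set y; z] \in cut_edges G ->
  [set x; y] \in F -> [set y; z] \in F ->
  {in [set x; y; z] &, forall u v, u != v -> ~~ connect (del F) u v}.
Proof.
move=> xz cxy cyz Fxy Fyz.
have sub e : e \in F -> subrel (connect (del F)) (connect (del [set e])).
  by move=> eF; apply: connect_delS; rewrite sub1set.
have [xy yz] := (cut_edge_ends cxy, cut_edge_ends cyz).
have nxy : ~~ connect (del F) x y.
  by apply: contraL cxy => /(sub _ Fxy) c; rewrite cut_edgeE // negbK.
have nyz : ~~ connect (del F) y z.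
  by apply: contraL cyz => /(sub _ Fyz) c; rewrite cut_edgeE // negbK.
(* A connection from [x] to [z] continued along the edge from [z] to [y] would bypass the bridge
   between [x] and [y]. *)
have nxz : ~~ connect (del F) x z.
  apply: contraL cxy => /(sub _ Fxy) c; rewrite cut_edgeE // negbK.
  apply: connect_trans c _; apply: connect1; rewrite /= adj_sym yz inE.
  apply/eqP => /set2_eq[][zx zy]; first by rewrite zx eqxx in xz.
  by rewrite zx adj_irr in yz.
move=> u v; rewrite !inE -!orbA => /or3P[]/eqP-> /or3P[]/eqP->;
  by rewrite ?eqxx // => _; rewrite connect_del_sym.
Qed.

(** * Adjacent bridges under the minimum degree condition *)

Section MinDegree.
Variable d : nat.
Hypothesis lf : linear_forest (cut_edge_subgraph G).
Hypothesis d_ge3 : 3 <= d.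
Hypothesis degree_ge : forall x : G, d <= degree x.

Lemma exists_non_cut_edge x : exists2 y, adj x y & [set x; y] \notin cut_edges G.
Proof.
have : ~~ ([set y | adj x y] \subset [set y | [set x; y] \in cut_edges G]).
  apply/negP => /subset_leq_card; apply/negP; rewrite -ltnNge.
  apply: leq_ltn_trans (linear_forest_cut_degree x lf) _.
  exact: leq_trans d_ge3 (degree_ge x).
by case/subsetPn=> y; rewrite in_set => xy; rewrite in_set; exists y.
Qed.

(* The component of [v] has three vertices, so one of them avoids [A :|: B],
   and the component contains all neighbours of that one. *)
Lemma component_card F (A B : {set G}) v :
  F \subset cut_edges G -> {in F, forall e, e \subset A :|: B} ->
  {in A &, forall x y, x != y -> ~~ connect (del F) x y} ->
  {in B &, forall x y, x != y -> ~~ connect (del F) x y} ->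
  d < #|connect (del F) v|.
Proof.
move=> sF FAB sepA sepB.
have [w vw nvw] := exists_non_cut_edge v.
have [z [vz zw nvz]] := non_cut_two_neighbors vw nvw.
have cv y : adj v y -> [set v; y] \notin cut_edges G -> connect (del F) v y.
  by move=> vy ny; apply: connect1; rewrite /= vy (contra (subsetP sF _)).
have [cvw cvz] := (cv w vw nvw, cv z vz nvz).
have cwz : connect (del F) w z.
  by rewrite connect_del_sym in cvw; apply: connect_trans cvw cvz.
have nevw : v != w by apply: contraTneq vw => ->; rewrite adj_irr.
have nevz : v != z by apply: contraTneq vz => ->; rewrite adj_irr.
have newz : w != z by rewrite eq_sym.
(* Pigeonhole: [v], [w], [z] are distinct and mutually connected, while each of [A] and [B] contains
   at most one vertex of a component. *)
have [t cvt nt] : exists2 t, connect (del F) v t & t \notin A :|: B.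
  case: (boolP (v \in A :|: B)) => [vAB|]; last by exists v.
  case: (boolP (w \in A :|: B)) => [wAB|]; last by exists w.
  case: (boolP (z \in A :|: B)) => [zAB|]; last by exists z.
  exfalso; move: vAB wAB zAB; rewrite !in_setU.
  case/orP=> hv /orP[] hw /orP[] hz;
    first [ by move: (sepA _ _ hv hw nevw); rewrite cvw
          | by move: (sepA _ _ hv hz nevz); rewrite cvz
          | by move: (sepA _ _ hw hz newz); rewrite cwz
          | by move: (sepB _ _ hv hw nevw); rewrite cvw
          | by move: (sepB _ _ hv hz nevz); rewrite cvz
          | by move: (sepB _ _ hw hz newz); rewrite cwz ].
apply: leq_ltn_trans (degree_ge t) _.
have -> : (degree t).+1 = #|t |: [set y | adj t y]|.
  by rewrite cardsU1 inE adj_irr.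
apply/subset_leq_card/subsetP => y; rewrite !inE => ty.
apply: connect_trans cvt _; case/orP: ty => [/eqP->|ty]; first exact: connect0.
apply: connect1; rewrite /= ty; apply: contra nt => /FAB/subsetP; apply.
exact: set21.
Qed.

Definition bridge_pair u v w :=
  [&& u != w, [set u; v] \in cut_edges G & [set v; w] \in cut_edges G].

Hypothesis card_lt : #|G| < 5 * d.+1.

(** Otherwise four distinct bridges can be deleted, leaving at least five components. By
    [component_card], with the two vertex triples as [A] and [B], each has at least [d.+1] vertices,
    against [card_lt]. *)
Lemma bridge_pairs_meet a b c x y z :
  bridge_pair a b c -> bridge_pair x y z ->
  ([set a; b] \in [:: [set x; y]; [set y; z]]) ||
  ([set b; c] \in [:: [set x; y]; [set y; z]]).
Proof.
move=> /and3P[ac ab bc] /and3P[xz xy yz]; apply/negPn/negP.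
rewrite negb_or => /andP[n1 n2].
pose l := [:: [set a; b]; [set b; c]; [set x; y]; [set y; z]].
have path_ne u v w : u != w -> [set u; v] != [set v; w].
  by move=> uw; apply/eqP => /set2_eq[][]// => *; subst; rewrite eqxx in uw.
have ul : uniq l.
  by rewrite /l /= inE negb_or path_ne //= n1 n2 !inE path_ne.
pose F := [set e in l].
have sF : F \subset cut_edges G.
  apply/subsetP => e; rewrite in_set.
  by do 4![case/predU1P=> [->//|]].
have mF e : e \in l -> e \in F by rewrite in_set.
have FAB : {in F, forall e, e \subset [set a; b; c] :|: [set x; y; z]}.
  move=> e; rewrite in_set => el; apply/subsetP => t te; move: te el.
  move=> te; do 4![case/predU1P=> [Ee|]; first by
    move: te; rewrite Ee !inE => /orP[]->; rewrite ?orbT].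
  by [].
have sepA := bridge_pair_disconnected (F := F) ac ab bc.
have sepB := bridge_pair_disconnected (F := F) xz xy yz.
have big v := component_card v sF FAB
  (sepA (mF _ _) (mF _ _)) (sepB (mF _ _) (mF _ _)).
have {big} big v : d < #|connect (del F) v|.
  by apply: big; rewrite !inE eqxx ?orbT.
have cF : #|F| = 4 by rewrite cardsE; apply/card_uniqP.
have := n_comp_del_cut_edges a sF; rewrite cF => n5.
have := leq_mul_n_comp (@connect_del_sym F) big.
apply/negP; rewrite -ltnNge; apply: leq_trans card_lt _.
by rewrite leq_mul2r n5 orbT.
Qed.

Lemma three_cut_edges v x y z :
  [set v; x] \in cut_edges G -> [set v; y] \in cut_edges G ->
  [set v; z] \in cut_edges G -> x != y -> y != z -> z != x -> False.
Proof.
move=> vx vy vz xy yz zx; have := linear_forest_cut_degree v lf.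
rewrite leqNgt => /negP; apply; apply/card_gt2P; exists x, y, z.
by split; split=> //; rewrite in_set.
Qed.

(** Turns a pair that contains one given bridge and misses another into a third bridge, attached to
    an end of the first. *)
Lemma bridge_pair_other x y z b c e :
  bridge_pair x y z -> [set b; c] \in [:: [set x; y]; [set y; z]] ->
  e \notin [:: [set x; y]; [set y; z]] ->
  exists q t, [/\ q = b \/ q = c, [set q; t] \in cut_edges G,
                 [set q; t] != [set b; c] & [set q; t] != e].
Proof.
move=> /and3P[xz xy yz] bc; rewrite !inE negb_or => /andP[n1 n2].
have ne : [set x; y] != [set y; z].
  by apply/eqP => /set2_eq[][]// => *; subst; rewrite eqxx in xz.
move: bc; rewrite !inE => /orP[]/eqP E.
  exists y, z; split=> //; [|by rewrite E eq_sym|by rewrite eq_sym].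
  by case: (set2_eq E) => -[-> ->]; tauto.
exists y, x; rewrite setUC; split=> //; [|by rewrite E|by rewrite eq_sym].
by case: (set2_eq E) => -[-> ->]; tauto.
Qed.

(** Fix a pair [a], [b], [c]. If neither of its bridges meets all pairs, there are two further
    bridges. At [b] they would be a third bridge, so one is at [c], leading to [t], and one at [a],
    leading to [s]. The pairs [b], [c], [t] and [b], [a], [s] must share a bridge, which forces
    [t = a] and [s = c]: a triangle of bridges. *)
Lemma bridge_cover :
  exists S, [/\ S \subset cut_edges G, {in S &, forall e f, e = f} &
    forall u v w, u != w -> [set u; v] \in cut_edges G ->
      [set v; w] \in cut_edges G -> ([set u; v] \in S) || ([set v; w] \in S)].
Proof.
have single f : f \in cut_edges G ->
    (forall u v w, bridge_pair u v w -> f \in [:: [set u; v]; [set v; w]]) ->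
    exists S, [/\ S \subset cut_edges G, {in S &, forall e f, e = f} &
    forall u v w, u != w -> [set u; v] \in cut_edges G ->
      [set v; w] \in cut_edges G -> ([set u; v] \in S) || ([set v; w] \in S)].
  move=> cf H; exists [set f]; split; first by rewrite sub1set.
    by move=> e e' /set1P-> /set1P->.
  move=> u v w uw uv vw; rewrite !in_set1 ![_ == f]eq_sym.
  have /H : bridge_pair u v w by apply/and3P.
  by rewrite !inE.
have [[[a b] c] /= abc|none] :=
  pickP (fun t : G * G * G => bridge_pair t.1.1 t.1.2 t.2);
  last first.
  exists set0; split; first exact: sub0set.
    by move=> e f; rewrite inE.
  move=> u v w uw uv vw; have /negP[] := none (u, v, w).
  exact/and3P.
have /and3P[ac ab bc] := abc.
have [[[x y] z] /= /andP[xyz n1]|] :=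
  pickP (fun t : G * G * G => bridge_pair t.1.1 t.1.2 t.2 &&
    ([set a; b] \notin [:: [set t.1.1; t.1.2]; [set t.1.2; t.2]])); last first.
  move=> H; apply: (single _ ab) => u v w uvw; apply/negPn/negP => n.
  by have := H (u, v, w); rewrite uvw n.
have [[[p q] r] /= /andP[pqr n2]|] :=
  pickP (fun t : G * G * G => bridge_pair t.1.1 t.1.2 t.2 &&
    ([set b; c] \notin [:: [set t.1.1; t.1.2]; [set t.1.2; t.2]])); last first.
  move=> H; apply: (single _ bc) => u v w uvw; apply/negPn/negP => n.
  by have := H (u, v, w); rewrite uvw n.
exfalso.
have ba : [set b; a] \in cut_edges G by rewrite setUC.
have [c1 [t [c1E c1t nbc nab]]] : exists q t, [/\ q = b \/ q = c,
    [set q; t] \in cut_edges G, [set q; t] != [set b; c] & [set q; t] != [set a; b]].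
  apply: (bridge_pair_other xyz _ n1).
  by have := bridge_pairs_meet abc xyz; rewrite (negPf n1).
have [a1 [s [a1E a1s nab' nbc']]] : exists q t, [/\ q = a \/ q = b,
    [set q; t] \in cut_edges G, [set q; t] != [set a; b] & [set q; t] != [set b; c]].
  apply: (bridge_pair_other pqr _ n2).
  by have := bridge_pairs_meet abc pqr; rewrite (negPf n2) orbF.
case: c1E => ?; subst c1.
  apply: (three_cut_edges ba bc c1t ac).
    by apply: contraNneq nbc => ->.
  by apply: contraNneq nab => ->; rewrite setUC.
case: a1E => ?; subst a1; last first.
  apply: (three_cut_edges ba bc a1s ac).
    by apply: contraNneq nbc' => ->.
  by apply: contraNneq nab' => ->; rewrite setUC.
have bct : bridge_pair b c t.
  rewrite /bridge_pair bc c1t !andbT; apply: contraNneq nbc => <-.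
  by rewrite setUC.
have bas : bridge_pair b a s.
  rewrite /bridge_pair ba a1s !andbT; apply: contraNneq nab' => <-.
  by [].
have E : [set c; t] = [set a; s].
  have := bridge_pairs_meet bct bas; rewrite !inE [[set b; a]]setUC (negPf nab) /=.
  rewrite ![[set b; c] == _]eq_sym (negPf nbc') orbF => /orP[/eqP E|/eqP->//].
  by case: (set2_eq E) => -[E1 E2]; subst; rewrite ?eqxx in ac.
have [ca|[cs ta]] := set2_eq E; first by case: ca => ca _; rewrite ca eqxx in ac.
subst s t.
(* Deleting the bridges at [b] must separate [a] from [c], but the edge joining them survives. *)
have sep := bridge_pair_disconnected (F := [set [set a; b]; [set b; c]]) ac ab bc
  (set21 _ _) (set22 _ _).
have /negP[] : ~~ connect (del [set [set a; b]; [set b; c]]) a c.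
  by apply: sep ac; rewrite !inE eqxx ?orbT.
apply: connect1; rewrite /= (cut_edge_ends a1s) !inE negb_or nab' /=.
exact: nbc'.
Qed.

End MinDegree.

End Graph.

Lemma min_degree_le (G : sgraph) (x : G) : min_degree G <= degree x.
Proof.
rewrite /min_degree; have := mem_index_enum x.
elim: (index_enum _) => [|y s IHs] //; rewrite big_cons geq_min.
by case/predU1P=> [->|/IHs ->]; rewrite ?leqnn ?orbT.
Qed.

Theorem theorem4p2 (G : sgraph) (n : nat) :
  #|G| = n ->
  9 <= n <= 24 ->
  connected G ->
  ~ complete G ->
  linear_forest (cut_edge_subgraph G) ->
  (Num.max 3%:R ((n%:R - 4%:R) / 5%:R) <= (min_degree G)%:R :> rat)%R ->
  cfc_eq G 2.
Proof.
move=> cardG _ cG ncG lf.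
rewrite Order.TotalTheory.ge_max => /andP[d3 dn].
rewrite Num.Theory.ler_nat in d3.
rewrite Num.Theory.ler_pdivrMr // Num.Theory.lerBlDr in dn.
rewrite -GRing.natrM -GRing.natrD Num.Theory.ler_nat in dn.
(* With the denominator cleared, [dn] reads [n <= min_degree G * 5 + 4], one vertex short of five
   components of size [(min_degree G).+1]. *)
have card_lt : #|G| < 5 * (min_degree G).+1 by rewrite cardG; lia.
have [S [sS S1 cover]] := bridge_cover lf d3 (@min_degree_le G) card_lt.
have [c cfc c2] := cfc_coloring_of_bridge_cover cG sS S1 cover.
split=> [|c']; last exact: cfc_num_colors_ge2.
by exists c => //; apply/eqP; rewrite eqn_leq c2 cfc_num_colors_ge2.
Qed.
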